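(* Let $w\in W_{n,r}$, let $S=\{e_1,\dots,e_n\}$ be linearly ordered by $e_1<\dots<e_n$, and let $M=M_w$. Then the image of $\lambda_M\colon \mathfrak{S}_n\to W_{n,r}$ is the principal order ideal $\{v\in W_{n,r} : v\le w\}$.
   Context: $W_{n,r}$ is the set of words of length $n$ on $\{0,1\}$ with exactly $r$ ones; for $w\in W_{n,r}$ and $1\le k\le r$, $\pi_k(w)$ is the position of the $k$-th $1$ in $w$; $W_{n,r}$ is partially ordered by $v\le w$ iff $\pi_k(v)\le\pi_k(w)$ for all $k$. $M_w$ is the matroid on $S$ whose independent sets are the $I\subseteq S$ with $|I\cap S_i|\le i$ for $0\le i\le r$, where $S_r=S$ and $S_{k-1}=\{e_1,\dots,e_{\pi_k(w)-1}\}$ for $1\le k\le r$. For a matroid $M$ on a linearly ordered set $\{f_1<\dots<f_n\}$ with closure operator $\mathrm{cl}$, its distinguished word is $x_1\cdots x_n$ with $x_i=0$ if $f_i\in\mathrm{cl}\{f_1,\dots,f_{i-1}\}$ and $x_i=1$ otherwise. The symmetric group $\mathfrak{S}_n$ acts on $S$ by $\sigma(e_i)=e_{\sigma(i)}$; $S_\sigma$ denotes $S$ with the linear order $\sigma(e_1)<\dots<\sigma(e_n)$, and $\lambda_M(\sigma)$ is the distinguished word of $M$ on $S_\sigma$. *)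

(* Defs.v *)
From mathcomp Require Import all_boot all_fingroup.
Set Implicit Arguments. Unset Strict Implicit. Unset Printing Implicit Defensive.

Record matroid (T : finType) := Matroid {
  indep : {set {set T}};
  indep0 : set0 \in indep;
  indepS : forall I J : {set T}, J \in indep -> I \subset J -> I \in indep;
  indep_aug : forall I J : {set T}, I \in indep -> J \in indep -> #|I| < #|J| ->
    exists2 x, x \in J :\: I & x |: I \in indep }.

Definition rank (T : finType) (M : matroid T) (A : {set T}) : nat :=
  \max_(I in indep M | I \subset A) #|I|.

Definition cl (T : finType) (M : matroid T) (A : {set T}) : {set T} :=
  [set x | rank M (x |: A) == rank M A].

(* The letters 0 and 1 are [false] and [true]. *)
Definition W (n r : nat) : {set n.-tuple bool} :=
  [set w : n.-tuple bool | count_mem true w == r].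

(* Positions are numbered from 1 and listed in increasing order. *)
Definition one_positions (n : nat) (w : n.-tuple bool) : seq nat :=
  [seq i <- iota 1 n | nth false w i.-1].

(* pi_k(w); meaningful only for 1 <= k <= r when [w \in W n r]. *)
Definition pos (n : nat) (k : nat) (w : n.-tuple bool) : nat :=
  nth 0 (one_positions w) k.-1.

Definition word_le (n r : nat) (v w : n.-tuple bool) : bool :=
  [forall k : 'I_r.+1, (0 < k) ==> (pos k v <= pos k w)].

(* The ground set {e_1 < ... < e_n} is ['I_n], e_j being the ordinal of value
   j - 1.  For i < r, [flag r w i] is {e_1, ..., e_(pi_(i+1)(w) - 1)}. *)
Definition flag (n r : nat) (w : n.-tuple bool) (i : nat) : {set 'I_n} :=
  if i == r then setT else [set j : 'I_n | j.+1 <= (pos i.+1 w).-1].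

Definition Mw_indep (n r : nat) (w : n.-tuple bool) : {set {set 'I_n}} :=
  [set I : {set 'I_n} | [forall i : 'I_r.+1, #|I :&: flag r w i| <= i]].

Lemma flag_total (n r : nat) (w : n.-tuple bool) i j :
  (flag r w i \subset flag r w j) || (flag r w j \subset flag r w i).
Proof.
rewrite /flag; case: eqP => _; first by rewrite subsetT orbT.
case: eqP => _; first by rewrite subsetT.
by case/orP: (leq_total (pos i.+1 w).-1 (pos j.+1 w).-1) => h;
  apply/orP; [left|right]; apply/subsetP => x; rewrite !inE => /leq_trans; apply.
Qed.

Lemma Mw_indep0 (n r : nat) (w : n.-tuple bool) : set0 \in Mw_indep r w.
Proof. by rewrite inE; apply/forallP => i; rewrite set0I cards0. Qed.

Lemma Mw_indepS (n r : nat) (w : n.-tuple bool) (I J : {set 'I_n}) :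
  J \in Mw_indep r w -> I \subset J -> I \in Mw_indep r w.
Proof.
rewrite !inE => /forallP hJ sIJ; apply/forallP => i.
by apply: leq_trans (hJ i); apply/subset_leq_card/setSI.
Qed.

Lemma Mw_indep_aug (n r : nat) (w : n.-tuple bool) (I J : {set 'I_n}) :
  I \in Mw_indep r w -> J \in Mw_indep r w -> #|I| < #|J| ->
  exists2 x, x \in J :\: I & x |: I \in Mw_indep r w.
Proof.
rewrite !inE => /forallP hI /forallP hJ ltIJ.
case: (boolP [exists x in J :\: I, x |: I \in Mw_indep r w]).
  by case/exists_inP=> x; exists x.
rewrite negb_exists_in => /forall_inP noaug.
pose F := flag r w.
have tightP x : x \in J :\: I ->
    exists2 i : 'I_r.+1, #|I :&: F i| == i & x \in F i.
  move=> xJI; have := noaug x xJI; rewrite inE negb_forall => /existsP[i].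
  rewrite -ltnNge setIUl => lti; exists i.
    rewrite eqn_leq hI /= -ltnS; apply: leq_trans lti _.
    apply: leq_trans (leq_card_setU _ _) _; rewrite -[in leqRHS]add1n leq_add2r.
    by rewrite -(cards1 x); apply/subset_leq_card/subsetIl.
  apply: contraLR lti => xF; rewrite -leqNgt.
  have -> : [set x] :&: F i = set0.
    by apply/setP => y; rewrite !inE; case: eqP => // ->; apply/negbTE.
  by rewrite set0U.
have [x0 x0JI] : exists x, x \in J :\: I.
  apply/set0Pn; apply: contraTneq ltIJ => /eqP; rewrite setD_eq0 -leqNgt.
  exact: subset_leq_card.
have [i0 ti0 _] := tightP x0 x0JI.
case: (arg_maxnP (P := fun i : 'I_r.+1 => #|I :&: F i| == i)
                 (fun i => #|F i|) ti0) => m /eqP tm maxm.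
have sub : J :\: I \subset F m.
  apply/subsetP => x /tightP[i ti xi].
  have /orP[s|s] := flag_total r w i m; first exact: (subsetP s).
  by move: xi; rewrite -/F; have /eqP <- : F m == F i by rewrite eqEcard s; apply: maxm.
suff : #|J| <= #|I| by rewrite leqNgt ltIJ.
rewrite -(cardsID (F m) J) -(cardsID (F m) I) leq_add //; first by rewrite tm hJ.
apply/subset_leq_card/subsetP => x; rewrite !inE => /andP[xF xJ].
rewrite xF /=; apply: contraR xF => xI.
by apply: (subsetP sub); rewrite !inE xI.
Qed.

Definition Mw (n r : nat) (w : n.-tuple bool) : matroid 'I_n :=
  Matroid (Mw_indep0 r w) (@Mw_indepS n r w) (@Mw_indep_aug n r w).

(* The linear order f_1 < ... < f_n on [T] is given by the list [f]. *)
Definition dist_word (n : nat) (T : finType) (M : matroid T) (f : n.-tuple T) :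
    n.-tuple bool :=
  [tuple tnth f i \notin cl M [set tnth f j | j : 'I_n & j < i] | i < n].

(* The list is that of S_sigma: sigma(e_1) < ... < sigma(e_n). *)
Definition lambda (n : nat) (M : matroid 'I_n) (s : 'S_n) : n.-tuple bool :=
  dist_word M [tuple s i | i < n].

(* Main.v *)
(** Words are compared through the number of ones in their prefixes: [v <= w]
    iff every prefix of [v] has at least as many ones as the prefix of [w] of
    the same length, and the prefix counts of [lambda_M(sigma)] are the ranks of
    the sets [{sigma(e_1), ..., sigma(e_m)}].  Any [m]-set [A] contains an
    independent set with as many elements as [w] has ones among its first [m]
    letters: keep the elements of [A] whose index in [A] is the position of a
    one.  Conversely, for [v <= w], let [sigma] send the k-th one (zero) of [v]
    to the k-th one (zero) of [w]; if the first [m] letters of [v] contain [c]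
    ones, then [sigma] sends the first [m] positions into [S_c], and [c] of them
    to ones of [w], which are independent, so their image has rank [c]. *)
Require Import Defs.
From mathcomp Require Import all_boot all_fingroup.
Set Implicit Arguments. Unset Strict Implicit. Unset Printing Implicit Defensive.

(** * Rank growth when one element is added *)

Section Rank.
Variables (T : finType) (M : matroid T).
Implicit Types (A B I : {set T}) (x : T).

Lemma leq_card_rank A I : I \in indep M -> I \subset A -> #|I| <= rank M A.
Proof.
move=> hI sIA; rewrite /rank.
by apply: (leq_bigmax_cond (P := fun J => (J \in indep M) && (J \subset A)));
  rewrite hI.
Qed.

Lemma rank_leqP A k :
  reflect (forall I, I \in indep M -> I \subset A -> #|I| <= k) (rank M A <= k).
Proof.
apply: (iffP idP) => [hA I hI sIA|h].
  exact: leq_trans (leq_card_rank hI sIA) hA.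
by apply/bigmax_leqP => I /andP[]; apply: h.
Qed.

Lemma rank_set0 : rank M set0 = 0.
Proof.
apply/eqP; rewrite -leqn0; apply/rank_leqP => I _.
by rewrite subset0 => /eqP->; rewrite cards0.
Qed.

Lemma rankS A B : A \subset B -> rank M A <= rank M B.
Proof.
move=> sAB; apply/rank_leqP => I hI sIA.
exact: leq_card_rank hI (subset_trans sIA sAB).
Qed.

Lemma rankU1_leq x A : rank M (x |: A) <= (rank M A).+1.
Proof.
apply/rank_leqP => I hI sI; rewrite (cardsD1 x I) -add1n leq_add ?leq_b1 //.
apply: leq_card_rank; first exact: indepS hI (subsetDl _ _).
by rewrite subDset.
Qed.

(** Turns the closure test behind a letter of a distinguished word into the 0/1 increment of the
    rank. *)
Lemma rankU1 x A : rank M (x |: A) = (x \notin cl M A) + rank M A.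
Proof.
rewrite inE; case: eqP => [-> //|/eqP ne]; apply/eqP.
by rewrite eqn_leq rankU1_leq /= add1n ltn_neqAle eq_sym ne rankS // subsetUr.
Qed.

End Rank.

(** * Letter counts in prefixes *)

Section Occurrences.
Variable n : nat.
Implicit Types (v w : n.-tuple bool) (b : bool) (k m : nat).

Definition occ b w m : nat := #|[set j : 'I_n | (tnth w j == b) && (j < m)]|.

Lemma occ0 b w : occ b w 0 = 0.
Proof. by apply: eq_card0 => j; rewrite inE andbF. Qed.

Lemma occS b w (j : 'I_n) : occ b w j.+1 = (tnth w j == b) + occ b w j.
Proof.
rewrite /occ; set A := [set _ | _ & _ < j.+1]; rewrite (cardsD1 j A).
rewrite inE ltnSn andbT; congr (_ + _); apply: eq_card => i.
by rewrite !inE ltnS (ltn_neqAle i) andbCA.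
Qed.

Lemma leq_occ b w m m' : m <= m' -> occ b w m <= occ b w m'.
Proof.
move=> le_mm'; apply/subset_leq_card/subsetP => j; rewrite !inE.
by case/andP=> -> /leq_trans->.
Qed.

Lemma occ_complement w m : m <= n -> occ true w m + occ false w m = m.
Proof.
elim: m => [|m IH] lt_mn; first by rewrite !occ0.
rewrite -[m]/(nat_of_ord (Ordinal lt_mn)) !occS addnACA IH ?(ltnW lt_mn) //.
by case: (tnth _ _).
Qed.

Lemma occ_inj b w (i j : 'I_n) :
  tnth w i = b -> tnth w j = b -> occ b w i = occ b w j -> i = j.
Proof.
move=> wi wj eq_ij; apply: val_inj => /=.
have [lt_ij|lt_ji|//] := ltngtP i j.
  by have := leq_occ b w lt_ij; rewrite occS wi eqxx eq_ij ltnn.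
by have := leq_occ b w lt_ji; rewrite occS wj eqxx eq_ij ltnn.
Qed.

Lemma occ_surj b w k :
  k < occ b w n -> exists2 j : 'I_n, tnth w j = b & occ b w j = k.
Proof.
move=> lt_k; have [m lt_km minm] := ex_minnP (ex_intro (fun m => k < occ b w m) n lt_k).
case: m => [|m] in lt_km minm; first by rewrite occ0 in lt_km.
have lt_mn : m < n by apply: minm.
have := lt_km; rewrite -[m]/(nat_of_ord (Ordinal lt_mn)) occS /=.
have le_mk : occ b w m <= k by rewrite leqNgt; apply/negP => /minm; rewrite ltnn.
case: eqP => [wb|_]; last by rewrite add0n ltnNge le_mk.
by rewrite add1n ltnS => le_km; exists (Ordinal lt_mn) => //; apply/eqP; rewrite eqn_leq le_mk.
Qed.

Lemma eq_from_occ v w :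
  (forall m, m <= n -> occ true v m = occ true w m) -> v = w.
Proof.
move=> eq_vw; apply: eq_from_tnth => j.
have := eq_vw _ (ltn_ord j); rewrite !occS eq_vw 1?ltnW // => /addIn.
by case: (tnth v j); case: (tnth w j).
Qed.

Lemma mem_W r w : (w \in W n r) = (occ true w n == r).
Proof.
rewrite inE /occ cardsE; congr (_ == r).
rewrite -[X in count_mem _ X](map_tnth_enum w) count_map cardE size_filter.
by rewrite -enumT; apply: eq_count => j /=; rewrite unfold_in ltn_ord andbT.
Qed.

(** * Positions of ones versus prefix counts *)

Lemma sorted_nth_leq (s : seq nat) k m : sorted ltn s -> k < size s ->
  (nth 0 s k <= m) = (k < count (leq^~ m) s).
Proof.
elim: s k => [|x s IH] k //= sxs.
have cnt0 : m < x -> count (leq^~ m) s = 0.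
  move=> lt_mx; apply/eqP; rewrite -leqn0 leqNgt -has_count.
  apply/hasPn => y /(allP (order_path_min ltn_trans sxs)) /= lt_xy.
  by rewrite -ltnNge (ltn_trans lt_mx).
case: k => [|k] /=; rewrite ?ltnS => lt_ks; last rewrite IH ?(path_sorted sxs) //.
  by case: (leqP x m) => [_|/cnt0->].
by case: (leqP x m) => [_|/cnt0->].
Qed.

Lemma count_one_positions w m :
  count (leq^~ m) (one_positions w) = occ true w m.
Proof.
rewrite /one_positions count_filter /occ cardsE (iotaDl 1 0).
rewrite count_map -val_enum_ord count_map cardE size_filter -enumT.
by apply: eq_count => j /=; rewrite add1n /= unfold_in andbC (tnth_nth false) eqb_id.
Qed.

(** The bounds on [k] keep [nth] within the list, away from its default 0. *)
Lemma pos_leq w k m : 0 < k <= occ true w n -> (pos k w <= m) = (k <= occ true w m).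
Proof.
case: k => //= k lt_k; rewrite sorted_nth_leq ?count_one_positions //.
  apply: sorted_filter; first exact: ltn_trans.
  exact: iota_ltn_sorted.
by apply: leq_trans lt_k _; rewrite -count_one_positions count_size.
Qed.

Lemma word_leP r v w : v \in W n r -> w \in W n r ->
  reflect (forall m, m <= n -> occ true w m <= occ true v m) (word_le r v w).
Proof.
rewrite !mem_W => /eqP vr /eqP wr; apply: (iffP forallP) => [le_vw m le_mn|le_vw k].
  case: (posnP (occ true w m)) => [-> //|wm_gt0].
  have lt_r : occ true w m < r.+1 by rewrite ltnS -wr leq_occ.
  (* Compare the last ones in the prefix of [w]: take [k = occ true w m]. *)
  have /implyP/(_ wm_gt0) := le_vw (Ordinal lt_r).
  rewrite -pos_leq /= ?vr ?wm_gt0 //; move/leq_trans; apply.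
  by rewrite pos_leq ?wm_gt0 ?wr.
apply/implyP => k_gt0; have le_kr : k <= r by rewrite -ltnS.
(* The prefix length used here is [pos k w]. *)
rewrite pos_leq ?vr ?k_gt0 //; apply: leq_trans (le_vw _ _).
  by rewrite -pos_leq ?wr ?k_gt0.
by rewrite pos_leq ?wr ?k_gt0.
Qed.

(** * Independence and rank in [Mw] *)

(** For [i < r] the flag stops just before the one numbered [i + 1]; for [i = r] both sides always
    hold. *)
Lemma mem_flag r w i j : w \in W n r -> i <= r ->
  (j \in flag r w i) = (occ true w j.+1 <= i).
Proof.
rewrite mem_W => /eqP wr le_ir; rewrite /flag; case: eqP => [->|/eqP ne].
  by rewrite inE -wr leq_occ.
have lt_ir : i < r by rewrite ltn_neqAle ne.
rewrite inE -ltnS prednK; last first.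
  by rewrite ltnNge pos_leq ?occ0 ?wr.
by rewrite ltnNge pos_leq ?wr // -leqNgt.
Qed.

Lemma card_ones_occ_leq w i :
  #|[set j : 'I_n | tnth w j & occ true w j.+1 <= i]| <= i.
Proof.
set A := [set _ | _ & _]; have [->|[j0 Aj0]] := set_0Vmem A; first by rewrite cards0.
case: (arg_maxnP (P := mem A) (fun j : 'I_n => j) Aj0) => j.
move=> /= + maxj; rewrite inE => /andP[_ le_ji]; apply: leq_trans le_ji.
apply/subset_leq_card/subsetP => i' Ai'; rewrite inE ltnS maxj // andbT eqb_id.
by move: Ai'; rewrite inE => /andP[].
Qed.

(** Flags are initial segments, so [g], moving elements down onto ones of [w], injects the part of
    [I] in a flag into the ones in that flag. *)
Lemma Mw_indep_inj r w (I : {set 'I_n}) (g : 'I_n -> 'I_n) : w \in W n r ->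
    {in I &, injective g} -> {in I, forall a, tnth w (g a) && (g a <= a)} ->
  I \in indep (Mw r w).
Proof.
move=> hw injg hg; rewrite inE; apply/forallP => i.
have le_ir : i <= r by rewrite -ltnS.
apply: leq_trans (card_ones_occ_leq w i).
rewrite -(card_in_imset (f := g) (D := I :&: _)); last first.
  by apply: sub_in2 injg; apply/subsetP; apply: subsetIl.
apply/subset_leq_card/subsetP => x /imsetP[a /setIP[Ia ai] ->]; move: ai.
rewrite mem_flag // => le_ai; have /andP[wga le_ga] := hg a Ia.
by rewrite inE wga (leq_trans (leq_occ _ _ _) le_ai).
Qed.

Lemma rank_flag_leq r w i (A : {set 'I_n}) :
  i <= r -> A \subset flag r w i -> rank (Mw r w) A <= i.
Proof.
move=> le_ir sA; apply/rank_leqP => I; rewrite inE => /forallP hI sIA.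
have := hI (Ordinal (le_ir : i < r.+1)).
by rewrite /= (setIidPl (subset_trans sIA sA)).
Qed.

Lemma card_ord_lt m : m <= n -> #|[set j : 'I_n | j < m]| = m.
Proof. by move=> le_mn; rewrite -sum1dep_card (big_ord_narrow le_mn) sum1_card card_ord. Qed.

Lemma occ_leq_rank r w (A : {set 'I_n}) : w \in W n r ->
  occ true w #|A| <= rank (Mw r w) A.
Proof.
(* For [a] in [A], the size of [below a] is the index of [a] in [A], counted from 0; [g] sends [a]
   to it. *)
move=> hw; pose below (a : 'I_n) := [set j in A | j < a].
have below_le (a : 'I_n) : #|below a| <= a.
  rewrite -[leqRHS](card_ord_lt (ltnW (ltn_ord a))).
  by apply/subset_leq_card/subsetP => j; rewrite !inE => /andP[].
pose g (a : 'I_n) : 'I_n := Ordinal (leq_ltn_trans (below_le a) (ltn_ord a)).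
have ltg (a a' : 'I_n) : a \in A -> a < a' -> g a < g a'.
  move=> Aa lt_a; apply/proper_card/properP; split.
    by apply/subsetP => j; rewrite !inE => /andP[-> /ltn_trans->].
  by exists a; rewrite !inE ?Aa ?ltnn.
have injg : {in A &, injective g}.
  move=> a a' Aa Aa' eq_g; apply: val_inj => /=.
  by have [/(ltg _ _ Aa)|/(ltg _ _ Aa')|//] := ltngtP a a'; rewrite eq_g ltnn.
have imgA : g @: A = [set j : 'I_n | j < #|A|].
  apply/eqP; rewrite eqEcard card_in_imset // card_ord_lt ?leqnn ?andbT; last first.
    by rewrite -[leqRHS](card_ord n) max_card.
  apply/subsetP => _ /imsetP[a Aa ->]; rewrite inE; apply/proper_card/properP.
  split; first by apply/subsetP => j; rewrite inE => /andP[].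
  by exists a; rewrite // inE ltnn andbF.
pose I := [set a in A | tnth w (g a)].
have sIA : I \subset A by apply/subsetP => a; rewrite inE => /andP[].
have injI : {in I &, injective g} by apply: sub_in2 injg; apply/subsetP.
have hI : I \in indep (Mw r w).
  apply: Mw_indep_inj hw injI _ => a; rewrite inE => /andP[_ ->].
  exact: below_le.
apply: leq_trans (leq_card_rank hI sIA); rewrite -(card_in_imset injI).
apply/subset_leq_card/subsetP => j; rewrite inE eqb_id => /andP[wj lt_j].
have : j \in g @: A by rewrite imgA inE.
by case/imsetP => a Aa def_j; apply/imsetP; exists a; rewrite // inE Aa -def_j.
Qed.

Lemma occ_lambda (M : matroid 'I_n) (s : 'S_n) m : m <= n ->
  occ true (lambda M s) m = rank M (s @: [set j : 'I_n | j < m]).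
Proof.
elim: m => [|m IH] lt_mn.
  have -> : [set j : 'I_n | j < 0] = set0 by apply/setP => j; rewrite !inE.
  by rewrite occ0 imset0 rank_set0.
pose j := Ordinal lt_mn; have IHj := IH (ltnW lt_mn).
(* The next letter is 1 exactly when the next element raises the rank. *)
rewrite -[m]/(nat_of_ord j) occS IHj.
have -> : [set i : 'I_n | i < j.+1] = j |: [set i : 'I_n | i < j].
  by apply/setP => i; rewrite !inE ltnS leq_eqVlt.
rewrite imsetU1 rankU1 tnth_mktuple eqb_id tnth_mktuple.
congr (nat_of_bool (_ \notin cl M _) + _).
apply/setP => x; apply/imsetP/imsetP => -[i]; rewrite !inE => lt_i ->;
  by exists i; rewrite ?inE // tnth_mktuple.
Qed.

Lemma occ_false_leq v w m : m <= n ->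
  occ true w m <= occ true v m -> occ false v m <= occ false w m.
Proof.
move=> le_mn; rewrite -(leq_add2r (occ false w m)) occ_complement //.
by rewrite -[X in X <= _](occ_complement v le_mn) leq_add2l.
Qed.

(** Equal totals of each letter guarantee a partner for every position; a letter and the number of
    its earlier occurrences determine a position, whence injectivity. *)
Lemma letter_matching r v w : v \in W n r -> w \in W n r ->
  exists s : 'S_n, forall i, tnth w (s i) = tnth v i /\
    occ (tnth v i) w (s i) = occ (tnth v i) v i.
Proof.
move=> hv hw; have occ_n b : occ b v n = occ b w n.
  move: hv hw; rewrite !mem_W => /eqP vr /eqP wr.
  case: b; first by rewrite vr wr.
  by apply/(@addnI r); rewrite -{1}vr -wr !occ_complement.
pose P i j := (tnth w j == tnth v i) && (occ (tnth v i) w j == occ (tnth v i) v i).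
have exP i : exists j, P i j.
  have lt_i : occ (tnth v i) v i < occ (tnth v i) w n.
    rewrite -occ_n; apply: leq_trans (leq_occ _ _ (ltn_ord i)).
    by rewrite occS eqxx.
  by have [j wj oj] := occ_surj lt_i; exists j; rewrite /P wj oj !eqxx.
pose f i := xchoose (exP i).
have fP i : tnth w (f i) = tnth v i /\ occ (tnth v i) w (f i) = occ (tnth v i) v i.
  by have /andP[/eqP ? /eqP ?] := xchooseP (exP i).
have injf : injective f.
  move=> i i' eq_f; have [wi oi] := fP i; have [wi' oi'] := fP i'.
  have eq_v : tnth v i' = tnth v i by rewrite -wi -wi' eq_f.
  by apply: (@occ_inj (tnth v i) v); rewrite // -oi eq_f -{1}eq_v oi' eq_v.
by exists (perm injf) => i; rewrite permE.
Qed.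

End Occurrences.

(** * The two inclusions *)

Lemma lambda_leq n r (w : n.-tuple bool) (s : 'S_n) : w \in W n r ->
  (lambda (Mw r w) s \in W n r) && word_le r (lambda (Mw r w) s) w.
Proof.
move=> hw; have wr : occ true w n = r by apply/eqP; rewrite -mem_W.
have le_occ m : m <= n -> occ true w m <= occ true (lambda (Mw r w) s) m.
  move=> le_mn; rewrite occ_lambda //.
  apply: leq_trans (occ_leq_rank _ hw).
  by rewrite card_imset ?card_ord_lt //; apply: perm_inj.
have hl : lambda (Mw r w) s \in W n r.
  rewrite mem_W eqn_leq -[X in _ && (X <= _)]wr le_occ // andbT occ_lambda //.
  by apply: rank_flag_leq; rewrite // /flag eqxx subsetT.
by rewrite hl; apply/word_leP.
Qed.

Lemma leq_lambda n r (v w : n.-tuple bool) : w \in W n r -> v \in W n r ->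
  word_le r v w -> exists s : 'S_n, v = lambda (Mw r w) s.
Proof.
move=> hw hv /(word_leP hv hw) le_wv.
have vr : occ true v n = r by apply/eqP; rewrite -mem_W.
have [s hs] := letter_matching hv hw; exists s.
apply: eq_from_occ => m le_mn; rewrite occ_lambda //; apply/eqP; rewrite eqn_leq.
apply/andP; split.
  pose I := s @: [set j : 'I_n | (tnth v j == true) && (j < m)].
  rewrite -[occ _ _ _](card_imset _ (@perm_inj _ s)); apply: leq_card_rank.
    (* The elements of [I] are already ones of [w], so nothing needs to move. *)
    apply: (Mw_indep_inj hw (g := id)) => [a a' _ _ //|_ /imsetP[j + ->]].
    by rewrite inE leqnn andbT => /andP[/eqP vj _]; have [-> _] := hs j.
  by apply/imsetS/subsetP => j; rewrite !inE => /andP[].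
have le_cr : occ true v m <= r by rewrite -vr leq_occ.
apply: rank_flag_leq => //; apply/subsetP => _ /imsetP[i + ->]; rewrite inE => lt_im.
rewrite mem_flag // occS; have [wsi osi] := hs i.
(* If [i] is a one of [v], the ones of [w] up to [s i] are as many as those of [v] up to [i]. *)
case vi: (tnth v i) in wsi osi *; rewrite wsi /=.
  apply: leq_trans (leq_occ _ _ lt_im).
  by rewrite occS vi osi.
(* If [i] is a zero, it moves down: prefixes of [v] have at most as many zeros as those of [w], so
   each zero of [w] comes no later than its partner in [v]. *)
suff le_si : s i <= i.
  apply: leq_trans (leq_occ _ _ le_si) _.
  exact: leq_trans (le_wv _ (ltnW (ltn_ord i))) (leq_occ _ _ (ltnW lt_im)).
rewrite leqNgt; apply/negP => lt_is.
have := occ_false_leq (ltn_ord i) (le_wv _ (ltn_ord i)).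
by rewrite occS vi eqxx -osi add1n ltnNge leq_occ.
Qed.

Theorem theorem7p5 (n r : nat) (w : n.-tuple bool) (hw : w \in W n r) :
  [set lambda (Mw r w) s | s : 'S_n] = [set v in W n r | word_le r v w].
Proof.
apply/setP => v; rewrite inE; apply/imsetP/andP => [[s _ ->]|[hv le_vw]].
  exact/andP/lambda_leq.
by have [s ->] := leq_lambda hw hv le_vw; exists s.
Qed.
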